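(* Let $L\subseteq\mathbb R^2$ be a line. Let $A\in\mathbb R^2$ be a radiant point not on $L$, and let $B$ be the reflection of $A$ with respect to $L$. Fix a real number $n\neq0$. If $|n|<1$, then the set of refracted rays (for the radiant point $A$ and the curve $L$) for the refraction constants $n$ and $-n$ coincides with the set of normals to the ellipse $$\|A-M\|+\|B-M\|=\frac{\|A-B\|}{|n|}.$$ If $|n|>1$, then the set of refracted rays for the refraction constant $n$ coincides with the set of normals to the hyperbola branch $$\|A-M\|-\|B-M\|=\frac{\|A-B\|}{-n}.$$
   Context: $\|\cdot\|$ is the Euclidean norm on $\mathbb R^2$; in the displayed equations $M$ ranges over points of $\mathbb R^2$. Normals to a curve are its normal lines. Refracted rays. Fix a radiant point $A\in\mathbb R^2$ and a plane curve $\mathcal C$ (here $\mathcal C=L$). For a smooth point $X\in\mathcal C$, $X\ne A$, the light ray $L(X)$ is the line through $A$ and $X$, and $N(X)$ is the normal line of $\mathcal C$ at $X$. For two lines $L_0,L_1$ meeting at $X$, the angle of $L_1$ with respect to $L_0$ is the unique $\theta\in(-\pi/2,\pi/2]$ by which $L_0$ must be rotated around $X$ to become $L_1$. Let $\theta_{\mathrm{in}}$ be the angle of $L(X)$ with respect to $N(X)$. For a real $n\ne0$ (the refraction constant) with $\frac1n\sin\theta_{\mathrm{in}}\in[-1,1]$, the refracted ray $R_n(X)$ is the line through $X$ whose angle $\theta_{\mathrm{out}}$ with respect to $N(X)$ satisfies $\sin\theta_{\mathrm{in}}=n\sin\theta_{\mathrm{out}}$ (with $\theta_{\mathrm{out}}=0$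 if $\theta_{\mathrm{in}}=0$). Refracted rays are full lines. *)

(* Defs.v *)
From Stdlib Require Import Reals Lra.
From Coquelicot Require Import Coquelicot.
Open Scope R_scope.

Definition point : Type := (R * R)%type.

(** Coquelicot's norm on the product [R * R] is the Euclidean one. *)
Lemma norm_point (x y : R) : norm ((x, y) : point) = sqrt (x ^ 2 + y ^ 2).
Proof.
  change (sqrt (Rabs x ^ 2 + Rabs y ^ 2) = sqrt (x ^ 2 + y ^ 2)).
  now rewrite !pow2_abs.
Qed.

Definition dot (u v : point) : R := fst u * fst v + snd u * snd v.

Definition line_along (P v : point) : point -> Prop :=
  fun M => exists t : R, M = plus P (scal t v).

Definition is_line (D : point -> Prop) : Prop :=
  exists P v : point, v <> zero /\ forall M, D M <-> line_along P v M.

Definition line_through (P Q : point) : point -> Prop :=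
  line_along P (minus Q P).

(** [B = A + 2 (H - A)], where [H] is the foot of the perpendicular from [A]
    to the line [L]. *)
Definition is_reflection (L : point -> Prop) (A B : point) : Prop :=
  exists H : point,
    L H /\ (forall P, L P -> dot (minus P H) (minus A H) = 0) /\
    B = plus A (scal 2 (minus H A)).

(** Counterclockwise rotation around [X]. *)
Definition rotate (X : point) (theta : R) (M : point) : point :=
  let v : point := minus M X in
  plus X (cos theta * fst v - sin theta * snd v,
          sin theta * fst v + cos theta * snd v).

(** [theta] is the angle of the line [L1] with respect to the line [L0], both
    passing through [X]. *)
Definition is_angle (X : point) (L0 L1 : point -> Prop) (theta : R) : Prop :=
  - (PI / 2) < theta <= PI / 2 /\
  forall M, L1 M <-> exists P, L0 P /\ M = rotate X theta P.

(** [g] is a smooth regular parametrization of the curve [C] near [X], with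
    [g 0 = X] and velocity [v] at [0].  The last clause says that every
    arc of [g] around [0] contains all the points of [C] close to [X]: near [X]
    the set [C] is then a single embedded arc, with tangent direction [v]. *)
Definition local_parametrization
    (C : point -> Prop) (X : point) (g : R -> point) (v : point) : Prop :=
  g 0 = X /\
  locally 0 (fun t => forall k : nat,
    ex_derive_n (fun s => fst (g s)) k t /\
    ex_derive_n (fun s => snd (g s)) k t) /\
  is_derive g 0 v /\ v <> zero /\
  locally 0 (fun t => C (g t)) /\
  forall eps : R, 0 < eps ->
    locally X (fun M => C M -> exists t, Rabs t < eps /\ g t = M).

(** [X] is a smooth point of [C] and [N] is the normal line of [C] at [X]. *)
Definition is_normal_at (C : point -> Prop) (X : point) (N : point -> Prop) :
    Prop :=
  exists (g : R -> point) (v : point),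
    local_parametrization C X g v /\
    forall M, N M <-> dot (minus M X) v = 0.

Definition normals (C : point -> Prop) (N : point -> Prop) : Prop :=
  exists X : point, C X /\ is_normal_at C X N.

(** [D] is the refracted ray at the point [X] of [C], for the radiant point [A]
    and the refraction constant [n]. *)
Definition is_refracted_ray_at (A : point) (C : point -> Prop) (n : R)
    (X : point) (D : point -> Prop) : Prop :=
  exists (N : point -> Prop) (theta_in theta_out : R),
    is_normal_at C X N /\
    is_angle X N (line_through A X) theta_in /\
    -1 <= 1 / n * sin theta_in <= 1 /\
    is_line D /\ D X /\
    is_angle X N D theta_out /\
    sin theta_in = n * sin theta_out /\
    (theta_in = 0 -> theta_out = 0).

Definition refracted_rays (A : point) (C : point -> Prop) (n : R)
    (D : point -> Prop) : Prop :=
  exists X : point, C X /\ X <> A /\ is_refracted_ray_at A C n X D.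

(* Main.v *)
Require Import Defs.
From Stdlib Require Import Reals Lra.
From Coquelicot Require Import Coquelicot.
Open Scope R_scope.

(** Take the foot of the perpendicular from [A] to [L] as origin and [L] as
    [x]-axis, so that [A = (0, a)] and [B = (0, -a)].  Both curves then satisfy
    [x^2 + m y^2 = a^2 m / n^2] with [m = 1 - n^2].  The refracted ray at [(X, 0)]
    with angle [t] to the vertical is [(x - X) cos t + y sin t = 0], where Snell's
    law reads [X = n r sin t] with [r^2 = X^2 + a^2].  It is the normal to the conic
    at [(- m X / n^2, r (cos t) / n)], and this correspondence is inverted by
    [X = - n^2 x / m].  In the elliptic case the requirement [cos t >= 0] selects
    [n] or [- n]; in the hyperbolic case it selects the branch. *)

(** The definition of a normal by local parametrizations makes the two directions unequal. That
    every normal is carried by the gradient follows by differentiating the equation along an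
    arbitrary parametrization. Conversely, a smooth arc through the given point that exhausts the
    curve nearby has to be exhibited: it is the orbit of the point under the one-parameter group of
    linear maps preserving [x^2 + m y^2], made of [cos] and [sin] when [m > 0] and of [cosh] and
    [sinh] when [m < 0]. The common equation comes from the eccentricity: both conics have foci [A]
    and [B], eccentricity [|n|] and focal semi-axis [a / |n|], so the remaining coefficient is
    [a^2 / n^2 - a^2 = a^2 m / n^2], positive or negative with [m]. The number [r] is the distance
    from [A] to [(X, 0)], so the sine of the angle of incidence is [X / r]. The half-open range of
    angles leaves exactly one of the unit vectors [(c, s)] and [(- c, - s)] normal to a given line,
    with [s = 1] when [c = 0]; passing to the other one keeps Snell's law if [n] becomes [- n]. *)

(** The first axis is [w] rotated by [- PI / 2], which makes the frame positively
    oriented. *)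
Definition frame (h w : point) (x y : R) : point :=
  plus h (x * snd w + y * fst w, y * snd w - x * fst w).

Ltac pt_simpl :=
  repeat progress (unfold frame, dot, rotate, line_through, line_along, minus, zero, plus, opp,
    scal, mult, prod_plus, prod_opp, prod_scal, prod_zero in *; simpl in *).

Lemma frame_eq (h w : point) (x y x' y' : R) (hw : dot w w = 1) :
  frame h w x y = frame h w x' y' -> x = x' /\ y = y'.
Proof.
  destruct h as [h1 h2], w as [w1 w2]; pt_simpl; intros E.
  injection E; intros E2 E1.
  assert (F1 : (x - x') * w2 + (y - y') * w1 = 0) by lra.
  assert (F2 : (y - y') * w2 - (x - x') * w1 = 0) by lra.
  split; apply Rminus_diag_uniq.
  - replace (x - x') with ((w1 * w1 + w2 * w2) * (x - x')) by (rewrite hw; ring).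
    replace ((w1 * w1 + w2 * w2) * (x - x')) with
      (w2 * ((x - x') * w2 + (y - y') * w1) - w1 * ((y - y') * w2 - (x - x') * w1)) by ring.
    rewrite F1, F2; ring.
  - replace (y - y') with ((w1 * w1 + w2 * w2) * (y - y')) by (rewrite hw; ring).
    replace ((w1 * w1 + w2 * w2) * (y - y')) with
      (w1 * ((x - x') * w2 + (y - y') * w1) + w2 * ((y - y') * w2 - (x - x') * w1)) by ring.
    rewrite F1, F2; ring.
Qed.

Definition abscissa (h w M : point) : R :=
  snd w * (fst M - fst h) - fst w * (snd M - snd h).
Definition ordinate (h w M : point) : R :=
  fst w * (fst M - fst h) + snd w * (snd M - snd h).

Lemma frame_coordinates (h w M : point) (hw : dot w w = 1) :
  M = frame h w (abscissa h w M) (ordinate h w M).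
Proof.
  destruct h as [h1 h2], w as [w1 w2], M as [m1 m2]; unfold abscissa, ordinate; pt_simpl.
  f_equal.
  - transitivity (h1 + (w1 * w1 + w2 * w2) * (m1 - h1)); [rewrite hw|]; ring.
  - transitivity (h2 + (w1 * w1 + w2 * w2) * (m2 - h2)); [rewrite hw|]; ring.
Qed.

Lemma abscissa_minus (h w : point) (x y : R) (M : point) (hw : dot w w = 1) :
  abscissa h w M - x =
  snd w * (fst M - fst (frame h w x y)) - fst w * (snd M - snd (frame h w x y)).
Proof.
  destruct h as [h1 h2], w as [w1 w2], M as [m1 m2]; unfold abscissa; pt_simpl.
  transitivity (w2 * (m1 - h1) - w1 * (m2 - h2) - x * (w1 * w1 + w2 * w2));
    [rewrite hw|]; ring.
Qed.

Lemma ordinate_minus (h w : point) (x y : R) (M : point) (hw : dot w w = 1) :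
  ordinate h w M - y =
  fst w * (fst M - fst (frame h w x y)) + snd w * (snd M - snd (frame h w x y)).
Proof.
  destruct h as [h1 h2], w as [w1 w2], M as [m1 m2]; unfold ordinate; pt_simpl.
  transitivity (w1 * (m1 - h1) + w2 * (m2 - h2) - y * (w1 * w1 + w2 * w2));
    [rewrite hw|]; ring.
Qed.

Lemma norm_minus_frame (h w : point) (x y x' y' : R) (hw : dot w w = 1) :
  norm (minus (frame h w x y) (frame h w x' y')) = sqrt ((x - x') ^ 2 + (y - y') ^ 2).
Proof.
  destruct h as [h1 h2], w as [w1 w2]; pt_simpl.
  rewrite norm_point; f_equal.
  transitivity ((w1 * w1 + w2 * w2) * ((x - x') ^ 2 + (y - y') ^ 2));
    [ring | rewrite hw; ring].
Qed.

Lemma dot_minus_frame (h w : point) (x y x' y' x1 y1 : R) (hw : dot w w = 1) :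
  dot (minus (frame h w x y) (frame h w x' y')) (frame zero w x1 y1) =
  (x - x') * x1 + (y - y') * y1.
Proof.
  destruct h as [h1 h2], w as [w1 w2]; pt_simpl.
  transitivity ((w1 * w1 + w2 * w2) * ((x - x') * x1 + (y - y') * y1));
    [ring | rewrite hw; ring].
Qed.

Lemma rotate_frame (h w : point) (X th x y : R) :
  rotate (frame h w X 0) th (frame h w x y) =
  frame h w (X + (cos th * (x - X) - sin th * y)) (sin th * (x - X) + cos th * y).
Proof.
  destruct h as [h1 h2], w as [w1 w2]; pt_simpl; f_equal; ring.
Qed.

Lemma line_through_frame (h w : point) (x0 y0 x1 y1 x y : R) (hw : dot w w = 1) :
  line_through (frame h w x0 y0) (frame h w x1 y1) (frame h w x y) <->
  exists t, x = x0 + t * (x1 - x0) /\ y = y0 + t * (y1 - y0).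
Proof.
  assert (E : forall t, plus (frame h w x0 y0)
      (scal t (minus (frame h w x1 y1) (frame h w x0 y0))) =
      frame h w (x0 + t * (x1 - x0)) (y0 + t * (y1 - y0))).
  { intros t; destruct h as [h1 h2], w as [w1 w2]; pt_simpl; f_equal; ring. }
  unfold line_through, line_along; split; intros [t Ht]; exists t.
  - rewrite E in Ht; exact (frame_eq _ _ _ _ _ _ hw Ht).
  - rewrite E; destruct Ht as [-> ->]; reflexivity.
Qed.

(** * Smooth functions and componentwise derivatives *)

Definition smooth (f : R -> R) : Prop := forall k t, ex_derive_n f k t.

(** A class closed under differentiation contains all iterated derivatives of its members, by
    induction on the order. No closed form of the [k]-th derivative has to be found. *)
Lemma smooth_of_class (P : (R -> R) -> Prop)
    (hP : forall f, P f -> exists f', P f' /\ forall t, is_derive f t (f' t)) (f : R -> R) :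
  P f -> smooth f.
Proof.
  assert (K : forall k g, P g -> exists gk, P gk /\ forall t, Derive_n g k t = gk t).
  { intros k g Hg; induction k as [|k [gk [Hk Ek]]].
    - exists g; split; [exact Hg | reflexivity].
    - destruct (hP gk Hk) as [g' [Hg' D]]; exists g'; split; [exact Hg'|].
      intros t; simpl; rewrite (Derive_ext _ gk t Ek); apply is_derive_unique, D. }
  intros Hf [|k] t; [exact I|].
  destruct (K k f Hf) as [fk [Hk Ek]]; destruct (hP fk Hk) as [f' [_ D]].
  simpl; apply (ex_derive_ext fk); [intros s; symmetry; apply Ek|].
  exists (f' t); apply D.
Qed.

Lemma smooth_affine (a b : R) : smooth (fun t => a + b * t).
Proof.
  apply (smooth_of_class (fun f => exists a b, forall t, f t = a + b * t));
    [|exists a, b; reflexivity].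
  intros f [p [q E]]; exists (fun _ => q); split; [exists q, 0; intros; ring|].
  intros t; apply (is_derive_ext (fun t => p + q * t)); [intros; symmetry; apply E|].
  auto_derive; [exact I | ring].
Qed.

Lemma smooth_cos_sin (a b : R) : smooth (fun t => a * cos t + b * sin t).
Proof.
  apply (smooth_of_class (fun f => exists a b, forall t, f t = a * cos t + b * sin t));
    [|exists a, b; reflexivity].
  intros f [p [q E]]; exists (fun t => q * cos t + - p * sin t).
  split; [exists q, (- p); reflexivity|].
  intros t; apply (is_derive_ext (fun t => p * cos t + q * sin t)); [intros; symmetry; apply E|].
  auto_derive; [exact I | ring].
Qed.

Lemma smooth_cosh_sinh (a b : R) : smooth (fun t => a * cosh t + b * sinh t).
Proof.
  apply (smooth_of_class (fun f => exists a b, forall t, f t = a * cosh t + b * sinh t));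
    [|exists a, b; reflexivity].
  intros f [p [q E]]; exists (fun t => q * cosh t + p * sinh t).
  split; [exists q, p; reflexivity|].
  intros t; apply (is_derive_ext (fun t => p * cosh t + q * sinh t)); [intros; symmetry; apply E|].
  unfold cosh, sinh; auto_derive; [exact I | field].
Qed.

Lemma smooth_lincomb (a b c : R) (f g : R -> R) :
  smooth f -> smooth g -> smooth (fun t => c + (a * f t + b * g t)).
Proof.
  intros Hf Hg k t.
  assert (S : forall k t, ex_derive_n (fun t => a * f t + b * g t) k t).
  { intros k' t'; apply ex_derive_n_plus; apply filter_forall; intros s j _;
      apply ex_derive_n_scal_l; auto. }
  apply (ex_derive_n_plus (fun _ => c)); apply filter_forall; intros s j _;
    [apply ex_derive_n_const | apply S].
Qed.

Lemma is_derive_pair (f g : R -> R) (t a b : R) :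
  is_derive f t a -> is_derive g t b ->
  is_derive (fun s => (f s, g s) : point) t ((a, b) : point).
Proof.
  intros Hf Hg; unfold is_derive in *.
  eapply filterdiff_ext_lin.
  - apply (filterdiff_comp_2 f g (fun x y => (x, y) : point)); [exact Hf | exact Hg|].
    apply filterdiff_linear, (is_linear_prod fst snd); [apply is_linear_fst | apply is_linear_snd].
  - reflexivity.
Qed.

Lemma is_derive_fst_snd (g : R -> point) (t : R) (v : point) :
  is_derive g t v ->
  is_derive (fun s => fst (g s)) t (fst v) /\ is_derive (fun s => snd (g s)) t (snd v).
Proof.
  intros H; split.
  - apply (filterdiff_comp g fst (fun y => scal y v) fst H).
    apply filterdiff_linear, is_linear_fst.
  - apply (filterdiff_comp g snd (fun y => scal y v) snd H).
    apply filterdiff_linear, is_linear_snd.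
Qed.

(** The eta-expanded form is the one that [auto_derive] leaves in its goals, so that [rewrite] finds
    it. *)
Lemma Derive_eta (f : R -> R) (t l : R) :
  is_derive f t l -> Derive (fun s : R => f s) t = l.
Proof. apply is_derive_unique. Qed.

Lemma is_derive_lincomb (f g : R -> R) (a b c t l l' : R) :
  is_derive f t l -> is_derive g t l' ->
  is_derive (fun s => c + (a * f s + b * g s)) t (a * l + b * l').
Proof.
  intros Hf Hg.
  assert (ex_derive f t) by (exists l; exact Hf).
  assert (ex_derive g t) by (exists l'; exact Hg).
  auto_derive; [auto|].
  rewrite (Derive_eta _ _ _ Hf), (Derive_eta _ _ _ Hg); ring.
Qed.

(** * Local parametrizations and normals in frame coordinates *)

Lemma local_parametrization_frame (h w : point) (hw : dot w w = 1) (C : point -> Prop)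
    (x0 y0 x1 y1 : R) (x y : R -> R) :
  x 0 = x0 -> y 0 = y0 -> smooth x -> smooth y ->
  is_derive x 0 x1 -> is_derive y 0 y1 -> x1 <> 0 \/ y1 <> 0 ->
  locally 0 (fun t => C (frame h w (x t) (y t))) ->
  (forall eps, 0 < eps -> exists d, 0 < d /\ forall x' y',
     Rabs (x' - x0) < d -> Rabs (y' - y0) < d -> C (frame h w x' y') ->
     exists t, Rabs t < eps /\ x t = x' /\ y t = y') ->
  local_parametrization C (frame h w x0 y0) (fun t => frame h w (x t) (y t))
    (frame zero w x1 y1).
Proof.
  intros Ex Ey Sx Sy Dx Dy Hv HC Heps.
  assert (hw' := hw); unfold dot in hw'.
  assert (B1 : Rabs (fst w) <= 1) by (apply Rabs_le; nra).
  assert (B2 : Rabs (snd w) <= 1) by (apply Rabs_le; nra).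
  split; [rewrite Ex, Ey; reflexivity|].
  split; [|split; [|split; [|split; [exact HC|]]]].
  - apply filter_forall; intros t k; split.
    + apply (ex_derive_n_ext (fun s => fst h + (snd w * x s + fst w * y s))).
      * intros s; unfold frame; simpl; unfold plus; simpl; ring.
      * apply smooth_lincomb; assumption.
    + apply (ex_derive_n_ext (fun s => snd h + (- fst w * x s + snd w * y s))).
      * intros s; unfold frame; simpl; unfold plus; simpl; ring.
      * apply smooth_lincomb; assumption.
  - assert (Ex1 : ex_derive x 0) by (exists x1; exact Dx).
    assert (Ey1 : ex_derive y 0) by (exists y1; exact Dy).
    replace (frame zero w x1 y1) with
      ((x1 * snd w + y1 * fst w, y1 * snd w - x1 * fst w) : point)
      by (destruct w; pt_simpl; f_equal; ring).
    apply is_derive_pair; unfold frame; simpl; unfold plus; simpl.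
    + auto_derive; [auto|].
      rewrite (Derive_eta _ _ _ Dx), (Derive_eta _ _ _ Dy); ring.
    + auto_derive; [auto|].
      rewrite (Derive_eta _ _ _ Dx), (Derive_eta _ _ _ Dy); ring.
  - intros E.
    assert (E0 : (zero : point) = frame zero w 0 0) by (destruct w; pt_simpl; f_equal; ring).
    rewrite E0 in E at 2; apply frame_eq in E; [|exact hw]; lra.
  - intros eps He; destruct (Heps eps He) as [d [Hd H]].
    (* Neighbourhoods of the product are boxes. Each frame coordinate is a combination of two
       original ones with coefficients at most 1 in absolute value, so half the side suffices. *)
    exists (mkposreal (d / 2) ltac:(lra)); intros M [H1 H2] CM.
    change (Rabs (fst M - fst (frame h w x0 y0)) < d / 2) in H1.
    change (Rabs (snd M - snd (frame h w x0 y0)) < d / 2) in H2.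
    assert (T : forall a b p q, Rabs a <= 1 -> Rabs b <= 1 -> Rabs p < d / 2 ->
      Rabs q < d / 2 -> Rabs (a * p + b * q) < d).
    { intros a b p q Ha Hb Hp Hq.
      eapply Rle_lt_trans; [apply Rabs_triang|]; rewrite !Rabs_mult.
      assert (Rabs a * Rabs p <= 1 * Rabs p) by (apply Rmult_le_compat_r; [apply Rabs_pos|lra]).
      assert (Rabs b * Rabs q <= 1 * Rabs q) by (apply Rmult_le_compat_r; [apply Rabs_pos|lra]).
      lra. }
    destruct (H (abscissa h w M) (ordinate h w M)) as [t [Ht [Xt Yt]]].
    + rewrite (abscissa_minus h w x0 y0 M hw); unfold Rminus at 1; rewrite Ropp_mult_distr_l.
      apply T; rewrite ?Rabs_Ropp; assumption.
    + rewrite (ordinate_minus h w x0 y0 M hw); apply T; assumption.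
    + rewrite <- frame_coordinates; assumption.
    + exists t; split; [exact Ht|].
      rewrite Xt, Yt; symmetry; apply frame_coordinates, hw.
Qed.

Lemma local_parametrization_coordinates (h w : point) (hw : dot w w = 1) (C : point -> Prop)
    (x0 y0 : R) (g : R -> point) (v : point) :
  local_parametrization C (frame h w x0 y0) g v ->
  exists (x y : R -> R) (x1 y1 : R),
    x 0 = x0 /\ y 0 = y0 /\ is_derive x 0 x1 /\ is_derive y 0 y1 /\
    v = frame zero w x1 y1 /\ (x1 <> 0 \/ y1 <> 0) /\
    locally 0 (fun t => C (frame h w (x t) (y t))).
Proof.
  intros [g0 [_ [Dg [v0 [HC _]]]]].
  destruct (is_derive_fst_snd _ _ _ Dg) as [D1 D2].
  exists (fun t => abscissa h w (g t)), (fun t => ordinate h w (g t)),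
    (abscissa zero w v), (ordinate zero w v).
  destruct (frame_eq h w _ _ _ _ hw (eq_trans (eq_sym (frame_coordinates h w (g 0) hw)) g0))
    as [Ex Ey].
  split; [exact Ex|]; split; [exact Ey|].
  split; [|split; [|split; [apply frame_coordinates, hw | split]]].
  - replace (abscissa zero w v) with (snd w * fst v + - fst w * snd v)
      by (unfold abscissa, zero; simpl; unfold zero; simpl; ring).
    apply (is_derive_ext (fun t => (fst w * snd h - snd w * fst h) +
      (snd w * fst (g t) + - fst w * snd (g t))));
      [intros t; unfold abscissa; match goal with |- ?l = ?r => change (@eq R l r) end; ring | apply is_derive_lincomb; assumption].
  - replace (ordinate zero w v) with (fst w * fst v + snd w * snd v)
      by (unfold ordinate, zero; simpl; unfold zero; simpl; ring).
    apply (is_derive_ext (fun t => - (fst w * fst h + snd w * snd h) +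
      (fst w * fst (g t) + snd w * snd (g t))));
      [intros t; unfold ordinate; match goal with |- ?l = ?r => change (@eq R l r) end; ring | apply is_derive_lincomb; assumption].
  - destruct (Req_dec (abscissa zero w v) 0) as [Zx|]; [|left; assumption].
    destruct (Req_dec (ordinate zero w v) 0) as [Zy|]; [|right; assumption].
    exfalso; apply v0; rewrite (frame_coordinates zero w v hw), Zx, Zy.
    destruct w; pt_simpl; f_equal; ring.
  - revert HC; apply filter_imp; intros t; rewrite <- frame_coordinates; auto.
Qed.

(** In the plane the orthogonal complement of [(p, q)] is spanned by [(q, - p)]; [l] is the
    coefficient of the projection of [(x1, y1)] onto that vector. *)
Lemma orthogonal_proportional (p q x1 y1 : R) :
  p <> 0 \/ q <> 0 -> x1 <> 0 \/ y1 <> 0 -> p * x1 + q * y1 = 0 ->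
  exists l, l <> 0 /\ x1 = l * q /\ y1 = - l * p.
Proof.
  intros Hpq H1 E.
  assert (N : 0 < p ^ 2 + q ^ 2) by (destruct Hpq; nra).
  assert (X : x1 = (x1 * q - y1 * p) / (p ^ 2 + q ^ 2) * q).
  { apply (Rmult_eq_reg_r (p ^ 2 + q ^ 2)); [|lra]; field_simplify; [|lra].
    replace (x1 * p ^ 2) with (p * (p * x1 + q * y1) - p * q * y1) by ring.
    rewrite E; ring. }
  assert (Y : y1 = - ((x1 * q - y1 * p) / (p ^ 2 + q ^ 2)) * p).
  { apply (Rmult_eq_reg_r (p ^ 2 + q ^ 2)); [|lra]; field_simplify; [|lra].
    replace (y1 * q ^ 2) with (q * (p * x1 + q * y1) - q * p * x1) by ring.
    rewrite E; ring. }
  exists ((x1 * q - y1 * p) / (p ^ 2 + q ^ 2)); split; [|split; assumption].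
  intros Z; rewrite Z in X, Y; lra.
Qed.

(** The equation is constant along any parametrization, so the velocity is orthogonal to the
    gradient [(2 a x0, 2 b y0 + e)]. A nonzero gradient therefore spans the normal whichever
    parametrization was chosen. The term [e * y] lets one lemma serve both the refracting line
    ([a = b = 0], [e = 1]) and the conics ([e = 0]). *)
Lemma normal_of_quadric (h w : point) (hw : dot w w = 1) (C N : point -> Prop)
    (a b e k x0 y0 : R) :
  (forall x y, C (frame h w x y) -> a * x ^ 2 + b * y ^ 2 + e * y = k) ->
  2 * a * x0 <> 0 \/ 2 * b * y0 + e <> 0 ->
  is_normal_at C (frame h w x0 y0) N ->
  forall x y, N (frame h w x y) <-> (2 * b * y0 + e) * (x - x0) = 2 * a * x0 * (y - y0).
Proof.
  intros HC grad [g [v [Hg HN]]] x y.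
  destruct (local_parametrization_coordinates h w hw C x0 y0 g v Hg)
    as [f1 [f2 [x1 [y1 [E1 [E2 [D1 [D2 [-> [v0 HL]]]]]]]]]].
  assert (T : 2 * a * x0 * x1 + (2 * b * y0 + e) * y1 = 0).
  { assert (Dk : is_derive (fun t => a * f1 t ^ 2 + b * f2 t ^ 2 + e * f2 t) 0 0).
    { apply (is_derive_ext_loc (fun _ => k)).
      - revert HL; apply filter_imp; intros t Ht; symmetry; apply HC, Ht.
      - auto_derive; [exact I | ring]. }
    assert (ex_derive f1 0) by (exists x1; exact D1).
    assert (ex_derive f2 0) by (exists y1; exact D2).
    assert (Dk' : is_derive (fun t => a * f1 t ^ 2 + b * f2 t ^ 2 + e * f2 t) 0
       (2 * a * x0 * x1 + (2 * b * y0 + e) * y1)).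
    { auto_derive; [auto|].
      rewrite (Derive_eta _ _ _ D1), (Derive_eta _ _ _ D2), E1, E2; ring. }
    apply is_derive_unique in Dk, Dk'; congruence. }
  destruct (orthogonal_proportional _ _ _ _ grad v0 T) as [l [l0 [-> ->]]].
  rewrite HN, dot_minus_frame by exact hw; split; intros E; [|nra].
  apply Rminus_diag_uniq, (Rmult_eq_reg_l l); [|exact l0]; nra.
Qed.

Lemma is_normal_frame (h w : point) (hw : dot w w = 1) (C N : point -> Prop)
    (x0 y0 x1 y1 : R) (g : R -> point) :
  local_parametrization C (frame h w x0 y0) g (frame zero w x1 y1) ->
  (forall x y, N (frame h w x y) <-> (x - x0) * x1 + (y - y0) * y1 = 0) ->
  is_normal_at C (frame h w x0 y0) N.
Proof.
  intros Hg HN; exists g, (frame zero w x1 y1); split; [exact Hg|].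
  intros M; rewrite (frame_coordinates h w M hw), HN, dot_minus_frame by exact hw; reflexivity.
Qed.

Lemma is_normal_line (h w : point) (hw : dot w w = 1) (L N : point -> Prop) (x0 : R) :
  (forall x y, L (frame h w x y) <-> y = 0) ->
  is_normal_at L (frame h w x0 0) N <-> forall x y, N (frame h w x y) <-> x = x0.
Proof.
  intros HL; split.
  - intros HN x y.
    rewrite (normal_of_quadric h w hw L N 0 0 1 0 x0 0); [split; intros; lra | | lra | exact HN].
    intros x' y' H; apply HL in H; lra.
  - intros HN; apply (is_normal_frame h w hw L N x0 0 1 0 (fun t => frame h w (x0 + 1 * t) (0 + 0 * t)));
      [|intros x y; rewrite HN; lra].
    apply (local_parametrization_frame h w hw L x0 0 1 0 (fun t => x0 + 1 * t) (fun t => 0 + 0 * t)).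
    + ring.
    + ring.
    + apply smooth_affine.
    + apply smooth_affine.
    + auto_derive; [exact I | ring].
    + auto_derive; [exact I | ring].
    + lra.
    + apply filter_forall; intros t; apply HL; ring.
    + intros eps He; exists eps; split; [exact He|]; intros x' y' Hx _ H; apply HL in H.
      exists (x' - x0); split; [exact Hx | lra].
Qed.

(** * Arcs of conics *)

Lemma small_linear (a b eta : R) :
  0 < eta ->
  exists d, 0 < d /\ forall u v, Rabs u < d -> Rabs v < d -> Rabs (a * u + b * v) < eta.
Proof.
  intros He.
  assert (Pa := Rabs_pos a); assert (Pb := Rabs_pos b).
  assert (K : 0 < Rabs a + Rabs b + 1) by lra.
  exists (eta / (Rabs a + Rabs b + 1)); split; [apply Rdiv_lt_0_compat; assumption|].
  intros u v Hu Hv.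
  apply Rmult_lt_compat_r with (r := Rabs a + Rabs b + 1) in Hu; [|exact K].
  apply Rmult_lt_compat_r with (r := Rabs a + Rabs b + 1) in Hv; [|exact K].
  unfold Rdiv in Hu, Hv; rewrite Rmult_assoc, Rinv_l, Rmult_1_r in Hu, Hv by lra.
  eapply Rle_lt_trans; [apply Rabs_triang|]; rewrite !Rabs_mult.
  assert (Pu := Rabs_pos u); assert (Pv := Rabs_pos v).
  apply Rmult_lt_reg_r with (1 := K).
  assert (Rabs a * (Rabs u * (Rabs a + Rabs b + 1)) <= Rabs a * eta)
    by (apply Rmult_le_compat_l; lra).
  assert (Rabs b * (Rabs v * (Rabs a + Rabs b + 1)) <= Rabs b * eta)
    by (apply Rmult_le_compat_l; lra).
  nra.
Qed.

Lemma asin_small (eps : R) :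
  0 < eps ->
  exists eta, 0 < eta /\ forall p q, 0 < p -> p ^ 2 + q ^ 2 = 1 -> Rabs q < eta ->
    exists t, Rabs t < eps /\ cos t = p /\ sin t = q.
Proof.
  (* The cap 1, below [PI / 2], keeps [e] and [- e] in the interval where the sine is increasing. *)
  intros He; set (e := Rmin eps 1).
  assert (e0 : 0 < e) by (apply Rmin_pos; lra).
  assert (e1 : e <= 1) by apply Rmin_r.
  assert (e2 : e <= eps) by apply Rmin_l.
  assert (P := PI2_1).
  exists (sin e); split; [apply sin_gt_0; lra|].
  intros p q Hp Hpq Hq; apply Rabs_def2 in Hq.
  assert (Q : -1 <= q <= 1) by nra.
  assert (B := asin_bound q).
  exists (asin q); split; [|split].
  - apply Rlt_le_trans with (2 := e2), Rabs_def1.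
    + apply sin_increasing_0; rewrite ?sin_asin; lra.
    + apply sin_increasing_0; rewrite ?sin_asin, ?sin_neg; lra.
  - rewrite cos_asin by exact Q; apply sqrt_lem_1; unfold Rsqr; nra.
  - apply sin_asin, Q.
Qed.

(** Here [p + q] and [p - q] play the roles of [exp t] and [exp (- t)], so [t = ln (p + q)].
    Closeness of [p + q] to 1 makes it positive, which already excludes the other branch of the
    hyperbola. *)
Lemma argsinh_small (eps : R) :
  0 < eps ->
  exists eta, 0 < eta /\ forall p q, p ^ 2 - q ^ 2 = 1 -> Rabs (p + q - 1) < eta ->
    exists t, Rabs t < eps /\ cosh t = p /\ sinh t = q.
Proof.
  intros He.
  assert (E1 : 1 < exp eps) by (rewrite <- exp_0; apply exp_increasing, He).
  assert (E2 : exp (- eps) < 1) by (rewrite <- exp_0; apply exp_increasing; lra).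
  assert (E3 := exp_pos (- eps)).
  exists (Rmin (exp eps - 1) (1 - exp (- eps))); split; [apply Rmin_pos; lra|].
  intros p q Hpq H.
  assert (M1 := Rmin_l (exp eps - 1) (1 - exp (- eps))).
  assert (M2 := Rmin_r (exp eps - 1) (1 - exp (- eps))).
  apply Rabs_def2 in H.
  assert (Z : 0 < p + q) by lra.
  assert (I : / (p + q) = p - q) by (apply Rmult_eq_reg_l with (p + q); [rewrite Rinv_r; nra | lra]).
  exists (ln (p + q)); split; [apply Rabs_def1|].
  - rewrite <- (ln_exp eps); apply ln_increasing; lra.
  - rewrite <- (ln_exp (- eps)); apply ln_increasing; lra.
  - unfold cosh, sinh; rewrite exp_Ropp, exp_ln, I by exact Z; split; field.
Qed.

(** The arc is the orbit of [(x0, y0)] under the group generated by [(x, y) -> (- k m y, k x)],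
    which preserves [x^2 + m y^2]. With [k = 1 / sqrt |m|] the square of the generator is minus or
    plus the identity, whence circular or hyperbolic functions. The hypothesis [0 < rho * m] gives
    an ellipse, or a hyperbola that avoids [y = 0], so that the sign of [y] singles out a branch. *)
Lemma conic_local_parametrization (h w : point) (hw : dot w w = 1) (C : point -> Prop)
    (m n rho x0 y0 : R) (hm : 0 < rho * m)
    (hC : forall x y, C (frame h w x y) <-> x ^ 2 + m * y ^ 2 = rho /\ (m < 0 -> 0 < n * y)) :
  C (frame h w x0 y0) ->
  exists k g, k <> 0 /\
    local_parametrization C (frame h w x0 y0) g (frame zero w (k * (- m * y0)) (k * x0)).
Proof.
  intros H0; apply hC in H0; destruct H0 as [E0 S0].
  assert (rho0 : rho <> 0) by (intros ->; lra).
  assert (U : (x0 ^ 2 + m * y0 ^ 2) / rho = 1) by (rewrite E0; field; exact rho0).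
  assert (m0 : m <> 0) by (intros ->; lra).
  assert (G : x0 <> 0 \/ y0 <> 0).
  { destruct (Req_dec x0 0) as [->|]; [right; intros ->; apply rho0; rewrite <- E0; ring | auto]. }
  destruct (Rlt_or_le 0 m) as [pm | nm].
  - set (k := / sqrt m).
    assert (sm := sqrt_lt_R0 m pm).
    assert (K : k * k * m = 1).
    { unfold k; rewrite <- (sqrt_sqrt m) at 3 by lra; field; lra. }
    assert (k0 : k <> 0) by (apply Rinv_neq_0_compat; lra).
    exists k, (fun t => frame h w (x0 * cos t + k * (- m * y0) * sin t)
                 (y0 * cos t + k * x0 * sin t)); split; [exact k0|].
    apply (local_parametrization_frame h w hw C x0 y0 _ _
      (fun t => x0 * cos t + k * (- m * y0) * sin t) (fun t => y0 * cos t + k * x0 * sin t)).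
    + rewrite cos_0, sin_0; ring.
    + rewrite cos_0, sin_0; ring.
    + apply smooth_cos_sin.
    + apply smooth_cos_sin.
    + auto_derive; [exact I | rewrite cos_0, sin_0; ring].
    + auto_derive; [exact I | rewrite cos_0, sin_0; ring].
    + destruct G; [right | left]; repeat apply Rmult_integral_contrapositive_currified; lra.
    + apply filter_forall; intros t; apply hC; split; [|lra].
      assert (T := sin2_cos2 t); unfold Rsqr in T.
      transitivity (cos t * cos t * (x0 ^ 2 + m * y0 ^ 2)
        + sin t * sin t * (k * k * m) * (x0 ^ 2 + m * y0 ^ 2)); [ring|].
      rewrite K, E0; transitivity ((sin t * sin t + cos t * cos t) * rho); [ring|].
      rewrite T; ring.
    + intros eps He; destruct (asin_small eps He) as [eta [Heta Ht]].
      (* The future cosine equals 1 plus this linear form, so the bound 1 makes it positive, as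
         [asin_small] requires. *)
      destruct (small_linear (x0 / rho) (m * y0 / rho) 1 Rlt_0_1) as [d1 [Hd1 L1]].
      destruct (small_linear (- (k * m * y0) / rho) (k * m * x0 / rho) eta Heta) as [d2 [Hd2 L2]].
      exists (Rmin d1 d2); split; [apply Rmin_pos; assumption|].
      intros x y Hx Hy Hxy; apply hC in Hxy; destruct Hxy as [Exy _].
      assert (M1 := Rmin_l d1 d2); assert (M2 := Rmin_r d1 d2).
      specialize (L1 (x - x0) (y - y0) ltac:(lra) ltac:(lra)).
      specialize (L2 (x - x0) (y - y0) ltac:(lra) ltac:(lra)).
      (* Solving the parametrization for [t]: the polar form of the quadratic form with [(x0, y0)]
         gives the cosine, the determinant with [(x0, y0)] gives the sine. *)
      destruct (Ht ((x * x0 + m * y * y0) / rho) (k * m * (y * x0 - x * y0) / rho))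
        as [t [T1 [T2 T3]]].
      * apply Rabs_def2 in L1.
        replace (x0 / rho * (x - x0) + m * y0 / rho * (y - y0)) with
          ((x * x0 + m * y * y0) / rho - (x0 ^ 2 + m * y0 ^ 2) / rho) in L1 by (field; lra).
        rewrite U in L1; lra.
      * transitivity (((x * x0 + m * y * y0) ^ 2 + k * k * m * m * (y * x0 - x * y0) ^ 2) / rho ^ 2);
          [field; lra|].
        rewrite K; transitivity ((x ^ 2 + m * y ^ 2) * (x0 ^ 2 + m * y0 ^ 2) / rho ^ 2);
          [field; lra | rewrite Exy, E0; field; lra].
      * replace (k * m * (y * x0 - x * y0) / rho) with
          (- (k * m * y0) / rho * (x - x0) + k * m * x0 / rho * (y - y0)) by (field; lra).
        exact L2.
      * exists t; split; [exact T1|]; rewrite T2, T3; split.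
        -- transitivity ((x * x0 ^ 2 + m * y * y0 * x0 - (k * k * m) * m * y0 * (y * x0 - x * y0)) / rho);
             [field; lra | rewrite K].
           transitivity (x * (x0 ^ 2 + m * y0 ^ 2) / rho); [field; lra | rewrite E0; field; lra].
        -- transitivity ((x * x0 * y0 + m * y * y0 ^ 2 + (k * k * m) * x0 * (y * x0 - x * y0)) / rho);
             [field; lra | rewrite K].
           transitivity (y * (x0 ^ 2 + m * y0 ^ 2) / rho); [field; lra | rewrite E0; field; lra].
  - assert (neg : m < 0) by lra.
    set (k := / sqrt (- m)).
    assert (sm := sqrt_lt_R0 (- m) ltac:(lra)).
    assert (K : k * k * m = - 1).
    { apply Ropp_eq_reg; rewrite Ropp_mult_distr_r; unfold k.
      rewrite <- (sqrt_sqrt (- m)) at 3 by lra; field; lra. }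
    assert (k0 : k <> 0) by (apply Rinv_neq_0_compat; lra).
    exists k, (fun t => frame h w (x0 * cosh t + k * (- m * y0) * sinh t)
                 (y0 * cosh t + k * x0 * sinh t)); split; [exact k0|].
    apply (local_parametrization_frame h w hw C x0 y0 _ _
      (fun t => x0 * cosh t + k * (- m * y0) * sinh t) (fun t => y0 * cosh t + k * x0 * sinh t)).
    + rewrite cosh_0, sinh_0; ring.
    + rewrite cosh_0, sinh_0; ring.
    + apply smooth_cosh_sinh.
    + apply smooth_cosh_sinh.
    + unfold cosh, sinh; auto_derive; [exact I | rewrite Ropp_0, exp_0; field].
    + unfold cosh, sinh; auto_derive; [exact I | rewrite Ropp_0, exp_0; field].
    + destruct G; [right | left]; repeat apply Rmult_integral_contrapositive_currified; lra.
    (* The branch condition is open, so continuity at 0 keeps the arc on the branch for small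
       [t]. *)
    + assert (Cn : continuous (fun t => n * (y0 * cosh t + k * x0 * sinh t)) 0).
      { apply (ex_derive_continuous (fun t => n * (y0 * cosh t + k * x0 * sinh t))).
        unfold cosh, sinh; auto_derive; exact I. }
      assert (Ps : locally 0 (fun t => 0 < n * (y0 * cosh t + k * x0 * sinh t))).
      { apply Cn, open_gt; rewrite cosh_0, sinh_0, Rmult_1_r, Rmult_0_r, Rplus_0_r; auto. }
      revert Ps; apply filter_imp; intros t Pt; apply hC; split; [|intros _; exact Pt].
      assert (T : cosh t * cosh t - sinh t * sinh t = 1).
      { transitivity (exp t * exp (- t)); [unfold cosh, sinh; field|].
        rewrite <- exp_plus, Rplus_opp_r; apply exp_0. }
      transitivity (cosh t * cosh t * (x0 ^ 2 + m * y0 ^ 2)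
        + sinh t * sinh t * (k * k * m) * (x0 ^ 2 + m * y0 ^ 2)); [ring|].
      rewrite K, E0; transitivity ((cosh t * cosh t - sinh t * sinh t) * rho); [ring|].
      rewrite T; ring.
    + intros eps He; destruct (argsinh_small eps He) as [eta [Heta Ht]].
      (* This form is [cosh t + sinh t - 1] for the values recovered below. The sign of the
         hyperbolic sine is reversed because [k * k * m = - 1]. *)
      destruct (small_linear ((x0 + k * m * y0) / rho) ((m * y0 - k * m * x0) / rho) eta Heta)
        as [d [Hd L1]].
      exists d; split; [exact Hd|].
      intros x y Hx Hy Hxy; apply hC in Hxy; destruct Hxy as [Exy _].
      specialize (L1 (x - x0) (y - y0) Hx Hy).
      destruct (Ht ((x * x0 + m * y * y0) / rho) (- (k * m * (y * x0 - x * y0)) / rho))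
        as [t [T1 [T2 T3]]].
      * transitivity (((x * x0 + m * y * y0) ^ 2 - k * k * m * m * (y * x0 - x * y0) ^ 2) / rho ^ 2);
          [field; lra|].
        rewrite K; transitivity ((x ^ 2 + m * y ^ 2) * (x0 ^ 2 + m * y0 ^ 2) / rho ^ 2);
          [field; lra | rewrite Exy, E0; field; lra].
      * replace ((x * x0 + m * y * y0) / rho + - (k * m * (y * x0 - x * y0)) / rho - 1) with
          ((x0 + k * m * y0) / rho * (x - x0) + (m * y0 - k * m * x0) / rho * (y - y0)
           + ((x0 ^ 2 + m * y0 ^ 2) / rho - 1)) by (field; lra).
        rewrite U, Rminus_diag, Rplus_0_r; exact L1.
      * exists t; split; [exact T1|]; rewrite T2, T3; split.
        -- transitivity ((x * x0 ^ 2 + m * y * y0 * x0 + (k * k * m) * m * y0 * (y * x0 - x * y0)) / rho);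
             [field; lra | rewrite K].
           transitivity (x * (x0 ^ 2 + m * y0 ^ 2) / rho); [field; lra | rewrite E0; field; lra].
        -- transitivity ((x * x0 * y0 + m * y * y0 ^ 2 - (k * k * m) * x0 * (y * x0 - x * y0)) / rho);
             [field; lra | rewrite K].
           transitivity (y * (x0 ^ 2 + m * y0 ^ 2) / rho); [field; lra | rewrite E0; field; lra].
Qed.

Lemma is_normal_conic (h w : point) (hw : dot w w = 1) (C N : point -> Prop)
    (m n rho x0 y0 : R) (hm : 0 < rho * m)
    (hC : forall x y, C (frame h w x y) <-> x ^ 2 + m * y ^ 2 = rho /\ (m < 0 -> 0 < n * y)) :
  C (frame h w x0 y0) ->
  is_normal_at C (frame h w x0 y0) N <->
  forall x y, N (frame h w x y) <-> m * y0 * (x - x0) = x0 * (y - y0).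
Proof.
  intros H0; assert (H1 := H0); apply hC in H1; destruct H1 as [E0 _]; split.
  - intros HN x y.
    rewrite (normal_of_quadric h w hw C N 1 m 0 rho x0 y0); [split; intros; lra | | | exact HN].
    + intros x' y' H; apply hC in H; lra.
    + destruct (Req_dec x0 0) as [->|]; [right | left; lra].
      intros Z; assert (m * y0 = 0) by lra; assert (rho = 0) by (rewrite <- E0; nra); nra.
  - intros HN.
    destruct (conic_local_parametrization h w hw C m n rho x0 y0 hm hC H0) as [k [g [k0 Hg]]].
    apply (is_normal_frame h w hw C N x0 y0 _ _ g Hg).
    intros x y; rewrite HN; split; intros E; [nra|].
    apply Rminus_diag_uniq, (Rmult_eq_reg_l k); [|exact k0]; nra.
Qed.

(** * Angles and refracted rays in coordinates *)

(** The angle is [asin s]. Its only forbidden value [- (PI / 2)] would need [s = -1], hence [c = 0],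
    where the hypothesis imposes [s = 1]. *)
Lemma angle_of_cos_sin (c s : R) :
  c ^ 2 + s ^ 2 = 1 -> 0 < c \/ (c = 0 /\ s = 1) ->
  exists th, - (PI / 2) < th <= PI / 2 /\ cos th = c /\ sin th = s /\ (s = 0 -> th = 0).
Proof.
  intros E Hc.
  assert (S : -1 <= s <= 1) by nra.
  assert (B := asin_bound s); assert (T := sin_asin s S).
  exists (asin s); split; [|split; [|split; [exact T | intros ->; apply asin_0]]].
  - split; [|lra].
    destruct (Req_dec (asin s) (- (PI / 2))) as [F|]; [exfalso | lra].
    rewrite F, sin_neg, sin_PI2 in T; subst s; nra.
  - rewrite cos_asin by exact S; apply sqrt_lem_1; unfold Rsqr; nra.
Qed.

Lemma cos_sin_of_angle (th : R) :
  - (PI / 2) < th <= PI / 2 -> 0 < cos th \/ (cos th = 0 /\ sin th = 1).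
Proof.
  intros [H1 [H2 | ->]]; [left; apply cos_gt_0; assumption | right].
  split; [apply cos_PI2 | apply sin_PI2].
Qed.

(** Rotating the vertical by [th] gives the direction [(- sin th, cos th)], orthogonal to
    [(cos th, sin th)]. *)
Lemma is_angle_frame (h w : point) (hw : dot w w = 1) (N D : point -> Prop) (X th : R)
    (hN : forall x y, N (frame h w x y) <-> x = X) :
  is_angle (frame h w X 0) N D th <->
  - (PI / 2) < th <= PI / 2 /\
  forall x y, D (frame h w x y) <-> (x - X) * cos th + y * sin th = 0.
Proof.
  assert (K : forall x y, (exists P, N P /\ frame h w x y = rotate (frame h w X 0) th P) <->
    (x - X) * cos th + y * sin th = 0).
  { assert (T := sin2_cos2 th); unfold Rsqr in T.
    intros x y; split.
    - intros [P [HP E]]; rewrite (frame_coordinates h w P hw) in HP, E; apply hN in HP.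
      rewrite rotate_frame, HP in E; apply frame_eq in E; [|exact hw].
      destruct E as [-> ->]; ring.
    - intros E; exists (frame h w X (cos th * y - sin th * (x - X))); split; [apply hN; reflexivity|].
      rewrite rotate_frame; f_equal.
      + transitivity (X + ((sin th * sin th + cos th * cos th) * (x - X)
          - cos th * ((x - X) * cos th + y * sin th))); [rewrite T, E|]; ring.
      + transitivity ((sin th * sin th + cos th * cos th) * y
          - sin th * ((x - X) * cos th + y * sin th)); [rewrite T, E|]; ring. }
  unfold is_angle; split; intros [R H]; (split; [exact R|]).
  - intros x y; rewrite H; apply K.
  - intros M; rewrite (frame_coordinates h w M hw), H, K; reflexivity.
Qed.

(** In the right triangle formed by [A], the origin and [(X, 0)] the hypotenuse is [r]. The vector
    from [(X, 0)] to [A] is [(- X, a)], so the angle has sine [X / r] and cosine [a / r]. *)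
Lemma angle_of_light_ray (h w : point) (hw : dot w w = 1) (N : point -> Prop) (a X th : R)
    (ha : 0 < a) (hN : forall x y, N (frame h w x y) <-> x = X) :
  is_angle (frame h w X 0) N (line_through (frame h w 0 a) (frame h w X 0)) th <->
  - (PI / 2) < th <= PI / 2 /\ sin th * sqrt (X ^ 2 + a ^ 2) = X.
Proof.
  assert (LT : forall x y, line_through (frame h w 0 a) (frame h w X 0) (frame h w x y) <->
    a * x + X * y = a * X).
  { intros x y; rewrite line_through_frame by exact hw; split.
    - intros [t [-> ->]]; ring.
    - intros E; exists (1 - y / a); split; [|field; lra].
      apply (Rmult_eq_reg_l a); [|lra]; field_simplify; lra. }
  set (r := sqrt (X ^ 2 + a ^ 2)).
  assert (r0 : 0 < r) by (apply sqrt_lt_R0; nra).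
  assert (r2 : r * r = X ^ 2 + a ^ 2) by (apply sqrt_sqrt; nra).
  assert (T := sin2_cos2 th); unfold Rsqr in T.
  rewrite (is_angle_frame h w hw N _ X th hN); split; intros [R H]; (split; [exact R|]).
  - assert (C : 0 <= cos th) by (apply cos_ge_0; lra).
    assert (E : a * sin th = X * cos th).
    { assert (F : a * (X - sin th) + X * cos th = a * X) by (apply LT, H; ring); lra. }
    (* The equations determine the cosine only up to sign; [0 <= cos th] and [0 < a] discard the
       second factor. *)
    assert (F : (a - r * cos th) * (a + r * cos th) = 0).
    { transitivity (a * a * (sin th * sin th + cos th * cos th) - (r * r) * (cos th * cos th));
        [rewrite T; ring | rewrite r2].
      transitivity ((a * sin th) * (a * sin th) - X ^ 2 * (cos th * cos th)); [ring|].
      rewrite E; ring. }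
    assert (G : a = r * cos th) by (apply Rmult_integral in F; destruct F; nra).
    assert (C0 : cos th <> 0) by (intros Z; rewrite Z in G; lra).
    apply (Rmult_eq_reg_r (cos th)); [|exact C0].
    rewrite <- E, G; ring.
  - assert (C : 0 <= cos th) by (apply cos_ge_0; lra).
    assert (G : a = r * cos th).
    { assert (F : (a - r * cos th) * (a + r * cos th) = 0).
      { transitivity (a * a - (r * r) * (cos th * cos th)); [ring|].
        replace (cos th * cos th) with (1 - sin th * sin th) by lra.
        transitivity (a * a - r * r + (sin th * r) * (sin th * r)); [ring|].
        rewrite H, r2; ring. }
      apply Rmult_integral in F; destruct F; nra. }
    intros x y; rewrite LT; split; intros E.
    + apply (Rmult_eq_reg_l r); [|lra].
      transitivity ((x - X) * (r * cos th) + y * (sin th * r)); [ring|].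
      rewrite <- G, H; lra.
    + assert (F : (x - X) * (r * cos th) + y * (sin th * r) = 0).
      { transitivity (r * ((x - X) * cos th + y * sin th)); [ring | rewrite E; ring]. }
      rewrite <- G, H in F; lra.
Qed.

(** [(- s, c)] is the unit direction vector of the refracted ray at the point
    [(X, 0)], and the last clause on [X] is Snell's law. *)
Lemma refracted_rays_frame (h w : point) (hw : dot w w = 1) (L : point -> Prop) (a n : R)
    (ha : 0 < a) (hn : n <> 0) (hL : forall x y, L (frame h w x y) <-> y = 0) (D : point -> Prop) :
  refracted_rays (frame h w 0 a) L n D <->
  exists X c s,
    c ^ 2 + s ^ 2 = 1 /\ (0 < c \/ (c = 0 /\ s = 1)) /\ X = n * s * sqrt (X ^ 2 + a ^ 2) /\
    forall x y, D (frame h w x y) <-> (x - X) * c + y * s = 0.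
Proof.
  split.
  - intros [P [LP [_ [N [ti [t [HN [Hi [_ [_ [_ [Ho [E _]]]]]]]]]]]]].
    rewrite (frame_coordinates h w P hw) in LP; apply hL in LP.
    rewrite (frame_coordinates h w P hw), LP in HN, Hi, Ho.
    set (X := abscissa h w P) in *.
    rewrite (is_normal_line h w hw L N X hL) in HN.
    rewrite (angle_of_light_ray h w hw N a X ti ha HN) in Hi; destruct Hi as [Ri Hi].
    rewrite (is_angle_frame h w hw N D X t HN) in Ho; destruct Ho as [Ro Ho].
    exists X, (cos t), (sin t); split; [|split; [|split]].
    + assert (T := sin2_cos2 t); unfold Rsqr in T; lra.
    + apply cos_sin_of_angle, Ro.
    + rewrite <- E; symmetry; exact Hi.
    + exact Ho.
  - intros [X [c [s [E [Hc [HX HD]]]]]].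
    set (r := sqrt (X ^ 2 + a ^ 2)) in HX.
    assert (r0 : 0 < r) by (apply sqrt_lt_R0; nra).
    assert (r2 : r * r = X ^ 2 + a ^ 2) by (apply sqrt_sqrt; nra).
    destruct (angle_of_cos_sin c s E Hc) as [t [Rt [Ct [St Zt]]]].
    destruct (angle_of_cos_sin (a / r) (X / r)) as [ti [Ri [Ci [Si _]]]].
    { transitivity ((X ^ 2 + a ^ 2) / (r * r)); [field; lra | rewrite r2; field; nra]. }
    { left; apply Rdiv_lt_0_compat; assumption. }
    assert (F : sin ti = n * s) by (rewrite Si, HX at 1; field; lra).
    set (N := fun M => abscissa h w M = X).
    assert (HN : forall x y, N (frame h w x y) <-> x = X).
    { intros x y; unfold N.
      destruct (frame_eq h w _ _ _ _ hw (frame_coordinates h w (frame h w x y) hw)) as [<- _].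
      reflexivity. }
    exists (frame h w X 0); split; [apply hL; reflexivity|]; split.
    { intros Z; apply frame_eq in Z; [lra | exact hw]. }
    exists N, ti, t; split; [|split; [|split; [|split; [|split; [|split; [|split]]]]]].
    + rewrite (is_normal_line h w hw L N X hL); exact HN.
    + rewrite (angle_of_light_ray h w hw N a X ti ha HN); split; [exact Ri|].
      fold r; rewrite Si; field; lra.
    + rewrite F; replace (1 / n * (n * s)) with s by (field; exact hn); nra.
    + exists (frame h w X 0), (frame zero w (- s) c); split.
      * intros Z; assert (Z0 : (zero : point) = frame zero w 0 0)
          by (destruct w; pt_simpl; f_equal; ring).
        rewrite Z0 in Z at 2; apply frame_eq in Z; [|exact hw]; nra.
      * assert (V : forall t, plus (frame h w X 0) (scal t (frame zero w (- s) c)) =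
            frame h w (X - t * s) (t * c))
          by (intros u; destruct h, w; pt_simpl; f_equal; ring).
        intros M; rewrite (frame_coordinates h w M hw) at 1; rewrite HD; split.
        (* The parameter is the inner product of the vector from [(X, 0)] to [M] with the unit
           direction [(- s, c)]. *)
        -- intros Z; exists (ordinate h w M * c - (abscissa h w M - X) * s); rewrite V.
           rewrite (frame_coordinates h w M hw) at 1.
           set (x := abscissa h w M) in *; set (y := ordinate h w M) in *; f_equal.
           ++ transitivity (X + (x - X) * (c ^ 2 + s ^ 2)); [rewrite E; ring|].
              transitivity (X - (y * c - (x - X) * s) * s + c * ((x - X) * c + y * s));
                [ring | rewrite Z; ring].
           ++ transitivity (y * (c ^ 2 + s ^ 2)); [rewrite E; ring|].
              transitivity ((y * c - (x - X) * s) * c + s * ((x - X) * c + y * s));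
                [ring | rewrite Z; ring].
        -- intros [u Hu]; rewrite V in Hu; rewrite (frame_coordinates h w M hw) in Hu.
           apply frame_eq in Hu; [|exact hw]; destruct Hu as [-> ->]; ring.
    + apply HD; ring.
    + rewrite (is_angle_frame h w hw N D X t HN), Ct, St; split; assumption.
    + rewrite St; exact F.
    + intros ->; rewrite sin_0 in F; apply Zt, (Rmult_eq_reg_l n); lra.
Qed.

(** * From the focal definitions to a quadratic equation *)

(** Since [q^2 - p^2 = 4 a y], fixing [p + q = 2 al] also fixes [q - p], and the focal distances
    become affine: [al - k y] and [al + k y]. Conversely the equation bounds [|y|] by [al], so these
    expressions are nonnegative and are the square roots. *)
Lemma ellipse_equation (a n x y : R) (ha : 0 < a) (hn : n <> 0) (h1 : Rabs n < 1) :
  sqrt (x ^ 2 + (a - y) ^ 2) + sqrt (x ^ 2 + (a + y) ^ 2) = 2 * a / Rabs n <->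
  x ^ 2 + (1 - n ^ 2) * y ^ 2 = a ^ 2 * (1 - n ^ 2) / n ^ 2.
Proof.
  assert (k0 := Rabs_pos_lt n hn); rewrite <- (pow2_abs n).
  set (k := Rabs n) in *; clearbody k; clear n hn.
  set (p := sqrt (x ^ 2 + (a - y) ^ 2)); set (q := sqrt (x ^ 2 + (a + y) ^ 2)).
  assert (p2 : p * p = x ^ 2 + (a - y) ^ 2)
    by (apply sqrt_sqrt, Rplus_le_le_0_compat; apply pow2_ge_0).
  assert (q2 : q * q = x ^ 2 + (a + y) ^ 2)
    by (apply sqrt_sqrt, Rplus_le_le_0_compat; apply pow2_ge_0).
  set (al := a / k).
  assert (al0 : 0 < al) by (apply Rdiv_lt_0_compat; assumption).
  assert (Ea : a = k * al) by (unfold al; field; lra).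
  replace (2 * a / k) with (2 * al) by (unfold al; field; lra).
  replace (a ^ 2 * (1 - k ^ 2) / k ^ 2) with (al ^ 2 * (1 - k ^ 2)) by (unfold al; field; lra).
  clearbody al; split; intros E.
  - assert (F : (p + q) * (q - p) = 4 * (k * al) * y) by (rewrite <- Ea; lra).
    rewrite E in F.
    assert (G : q - p = 2 * k * y) by (apply (Rmult_eq_reg_l (2 * al)); lra).
    assert (Q : p = al - k * y) by lra.
    rewrite Q, Ea in p2; nra.
  - assert (Y : y ^ 2 <= al ^ 2).
    { apply (Rmult_le_reg_l (1 - k ^ 2)); nra. }
    assert (Y' : - al <= y <= al) by (split; nra).
    assert (KY : - al <= k * y <= al) by (split; nra).
    assert (P : p = al - k * y) by (apply sqrt_lem_1; [rewrite <- ?p2, <- ?q2; apply Rle_0_sqr | lra | rewrite Ea; nra]).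
    assert (Q : q = al + k * y) by (apply sqrt_lem_1; [rewrite <- ?p2, <- ?q2; apply Rle_0_sqr | lra | rewrite Ea; nra]).
    lra.
Qed.

(** The same identity with [q - p = 2 al] yields [q + p = 2 n y], where [al = a / n] carries the
    sign of [n]: the branch condition is the positivity of [p + q]. In the converse it is needed to
    pass from [al^2 <= (n y)^2] to the nonnegativity of [n y - al] and [n y + al]. *)
Lemma hyperbola_equation (a n x y : R) (ha : 0 < a) (h1 : 1 < Rabs n) :
  sqrt (x ^ 2 + (a - y) ^ 2) - sqrt (x ^ 2 + (a + y) ^ 2) = 2 * a / - n <->
  x ^ 2 + (1 - n ^ 2) * y ^ 2 = a ^ 2 * (1 - n ^ 2) / n ^ 2 /\ 0 < n * y.
Proof.
  assert (n0 : n <> 0) by (intros ->; rewrite Rabs_R0 in h1; lra).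
  assert (n2 : 1 < n ^ 2) by (rewrite <- pow2_abs; nra).
  set (p := sqrt (x ^ 2 + (a - y) ^ 2)); set (q := sqrt (x ^ 2 + (a + y) ^ 2)).
  assert (p2 : p * p = x ^ 2 + (a - y) ^ 2)
    by (apply sqrt_sqrt, Rplus_le_le_0_compat; apply pow2_ge_0).
  assert (q2 : q * q = x ^ 2 + (a + y) ^ 2)
    by (apply sqrt_sqrt, Rplus_le_le_0_compat; apply pow2_ge_0).
  assert (p0 : 0 <= p) by apply sqrt_pos.
  assert (q0 : 0 <= q) by apply sqrt_pos.
  set (al := a / n).
  assert (Ea : a = n * al) by (unfold al; field; lra).
  assert (al0 : al <> 0) by (intros Z; rewrite Z in Ea; lra).
  replace (2 * a / - n) with (- 2 * al) by (unfold al; field; lra).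
  replace (a ^ 2 * (1 - n ^ 2) / n ^ 2) with (al ^ 2 * (1 - n ^ 2)) by (unfold al; field; lra).
  clearbody al; split.
  - intros E.
    assert (F : (q - p) * (q + p) = 4 * (n * al) * y) by (rewrite <- Ea; lra).
    replace (q - p) with (2 * al) in F by lra.
    assert (G : q + p = 2 * (n * y)) by (apply (Rmult_eq_reg_l (2 * al)); lra).
    assert (P : p = n * y - al) by lra.
    assert (Q : q = n * y + al) by lra.
    split; [rewrite P, Ea in p2; nra | nra].
  - intros [E Y].
    assert (Y2 : al ^ 2 <= (n * y) ^ 2).
    { apply (Rmult_le_reg_l (n ^ 2 - 1)); [lra|].
      apply Rle_trans with (n ^ 2 * ((n ^ 2 - 1) * y ^ 2)); [|right; ring].
      replace ((n ^ 2 - 1) * y ^ 2) with (x ^ 2 + (n ^ 2 - 1) * al ^ 2) by lra.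
      assert (S1 := pow2_ge_0 (n * x)); assert (S2 := pow2_ge_0 ((n ^ 2 - 1) * al)); lra. }
    assert (Z : - (n * y) <= al <= n * y) by (split; nra).
    assert (P : p = n * y - al) by (apply sqrt_lem_1; [rewrite <- ?p2, <- ?q2; apply Rle_0_sqr | lra | rewrite Ea; nra]).
    assert (Q : q = n * y + al) by (apply sqrt_lem_1; [rewrite <- ?p2, <- ?q2; apply Rle_0_sqr | lra | rewrite Ea; nra]).
    lra.
Qed.

(** The correspondence between the point [(X, 0)], with [X = n s r], of the
    refracting line and the point of the conic where the refracted ray is normal. *)
Lemma refracted_normal_equation (n r c s x y : R) (hn : n <> 0) (hr : r <> 0) (h1 : n ^ 2 <> 1) :
  (1 - n ^ 2) * (c * r / n) * (x - - (1 - n ^ 2) * s * r / n) =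
    - (1 - n ^ 2) * s * r / n * (y - c * r / n) <->
  (x - n * s * r) * c + y * s = 0.
Proof.
  assert (E : (1 - n ^ 2) * (c * r / n) * (x - - (1 - n ^ 2) * s * r / n) -
    - (1 - n ^ 2) * s * r / n * (y - c * r / n) =
    (1 - n ^ 2) * r / n * ((x - n * s * r) * c + y * s)) by (field; exact hn).
  split; intros H.
  - apply (Rmult_eq_reg_l ((1 - n ^ 2) * r / n)); [lra|].
    unfold Rdiv; repeat apply Rmult_integral_contrapositive_currified;
      [lra | exact hr | apply Rinv_neq_0_compat, hn].
  - rewrite H in E; lra.
Qed.

(** * Refracted rays as normals, and conversely *)

Lemma conic_constant_pos (a n : R) :
  0 < a -> n <> 0 -> n ^ 2 <> 1 -> 0 < a ^ 2 * (1 - n ^ 2) / n ^ 2 * (1 - n ^ 2).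
Proof.
  intros ha hn h1.
  replace (a ^ 2 * (1 - n ^ 2) / n ^ 2 * (1 - n ^ 2)) with ((a * (1 - n ^ 2) / n) ^ 2)
    by (field; exact hn).
  apply pow2_gt_0; unfold Rdiv; repeat apply Rmult_integral_contrapositive_currified;
    [lra | lra | apply Rinv_neq_0_compat, hn].
Qed.

(** The constant [k] of the ray is separate from [n] because the ellipse depends only on [n^2] and
    receives the rays of both signs; on the hyperbola the branch forces [k = n]. *)
Lemma refracted_ray_is_normal (h w : point) (hw : dot w w = 1) (L C D : point -> Prop) (a n k : R)
    (ha : 0 < a) (hn : n <> 0) (h1 : n ^ 2 <> 1) (hL : forall x y, L (frame h w x y) <-> y = 0)
    (hC : forall x y, C (frame h w x y) <->
       x ^ 2 + (1 - n ^ 2) * y ^ 2 = a ^ 2 * (1 - n ^ 2) / n ^ 2 /\ (1 - n ^ 2 < 0 -> 0 < n * y))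
    (hk : k ^ 2 = n ^ 2) (hk' : 1 - n ^ 2 < 0 -> k = n) :
  refracted_rays (frame h w 0 a) L k D -> normals C D.
Proof.
  assert (k0 : k <> 0) by (intros ->; apply hn, Rsqr_0_uniq; unfold Rsqr; lra).
  rewrite (refracted_rays_frame h w hw L a k ha k0 hL).
  intros [X [c [s [E [Hc [HX HD]]]]]].
  set (r := sqrt (X ^ 2 + a ^ 2)) in HX.
  assert (r0 : 0 < r) by (apply sqrt_lt_R0; nra).
  assert (r2 : r * r = X ^ 2 + a ^ 2) by (apply sqrt_sqrt; nra).
  set (x0 := - (1 - k ^ 2) * s * r / k); set (y0 := c * r / k).
  assert (C0 : C (frame h w x0 y0)).
  { apply hC; split.
    - rewrite <- hk.
      transitivity ((1 - k ^ 2) * (r * r * (c ^ 2 + s ^ 2) - (k * s * r) ^ 2) / k ^ 2);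
        [unfold x0, y0; field; exact k0|].
      rewrite E, <- HX, r2; field; exact k0.
    - intros neg; rewrite <- (hk' neg); unfold y0.
      replace (k * (c * r / k)) with (c * r) by (field; exact k0).
      apply Rmult_lt_0_compat; [|exact r0].
      (* A grazing ray would have [X = k r] with [k^2 > 1], whereas [|X| < r]. *)
      destruct Hc as [|[_ S]]; [assumption | exfalso].
      rewrite S in HX; nra. }
  exists (frame h w x0 y0); split; [exact C0|].
  apply (is_normal_conic h w hw C D (1 - n ^ 2) n (a ^ 2 * (1 - n ^ 2) / n ^ 2) x0 y0).
  - apply conic_constant_pos; assumption.
  - exact hC.
  - exact C0.
  - intros x y; rewrite HD, HX, <- hk; unfold x0, y0.
    symmetry; apply refracted_normal_equation; lra.
Qed.

(** The normal yields [(c, s)] satisfying Snell's law for [n]. If this vector lies on the wrong half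
    of the circle, its opposite satisfies the law for [- n] with the same [X] and the same line. On
    the hyperbola [0 < n * y0] makes [c] positive, so this never occurs. *)
Lemma normal_is_refracted_ray (h w : point) (hw : dot w w = 1) (L C D : point -> Prop) (a n : R)
    (ha : 0 < a) (hn : n <> 0) (h1 : n ^ 2 <> 1) (hL : forall x y, L (frame h w x y) <-> y = 0)
    (hC : forall x y, C (frame h w x y) <->
       x ^ 2 + (1 - n ^ 2) * y ^ 2 = a ^ 2 * (1 - n ^ 2) / n ^ 2 /\ (1 - n ^ 2 < 0 -> 0 < n * y)) :
  normals C D ->
  refracted_rays (frame h w 0 a) L n D \/
  (0 < 1 - n ^ 2 /\ refracted_rays (frame h w 0 a) L (- n) D).
Proof.
  intros [P [HP HN]]; rewrite (frame_coordinates h w P hw) in HP, HN.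
  set (x0 := abscissa h w P) in *; set (y0 := ordinate h w P) in *.
  rewrite (is_normal_conic h w hw C D (1 - n ^ 2) n (a ^ 2 * (1 - n ^ 2) / n ^ 2) x0 y0
    (conic_constant_pos a n ha hn h1) hC HP)
    in HN.
  apply hC in HP; destruct HP as [E0 S0].
  (* For [y0 <> 0] this is where the normal meets [L]; for [y0 = 0] the normal is [L] itself and the
     formula selects a point on it. *)
  set (X := - x0 * n ^ 2 / (1 - n ^ 2)).
  set (r := sqrt (X ^ 2 + a ^ 2)).
  assert (r0 : 0 < r) by (apply sqrt_lt_R0; nra).
  assert (r2 : r * r = X ^ 2 + a ^ 2) by (apply sqrt_sqrt; nra).
  set (c := n * y0 / r); set (s := X / (n * r)).
  assert (E : c ^ 2 + s ^ 2 = 1).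
  { transitivity ((n ^ 2 / (1 - n ^ 2) * (x0 ^ 2 + (1 - n ^ 2) * y0 ^ 2) + X ^ 2) / (r * r)).
    - unfold c, s, X; field; lra.
    - rewrite E0, r2; field; nra. }
  assert (HX : X = n * s * r) by (unfold s; field; lra).
  assert (HD : forall x y, D (frame h w x y) <-> (x - X) * c + y * s = 0).
  { intros x y; rewrite HN, HX.
    rewrite <- (refracted_normal_equation n r c s x y hn) by lra.
    replace (- (1 - n ^ 2) * s * r / n) with x0 by (unfold s, X; field; lra).
    replace (c * r / n) with y0 by (unfold c; field; lra).
    reflexivity. }
  destruct (Rtotal_order 0 c) as [pc | [zc | nc]].
  - left; apply (refracted_rays_frame h w hw L a n ha hn hL); exists X, c, s; auto.
  - assert (S : s = 1 \/ s = -1).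
    { assert (F : (s - 1) * (s + 1) = 0) by (rewrite <- zc in E; lra).
      apply Rmult_integral in F; destruct F; [left | right]; lra. }
    destruct S as [S | S].
    (* Here [c = 0], so the normal is [L]: the grazing ray, which belongs to [n] or to [- n]
       according to the sign of [s]. *)
    + left; apply (refracted_rays_frame h w hw L a n ha hn hL); exists X, c, s; auto.
    + right; split.
      * apply Rnot_le_lt; intros N; specialize (S0 ltac:(lra)).
        assert (0 < c) by (apply Rdiv_lt_0_compat; assumption); lra.
      * apply (refracted_rays_frame h w hw L a (- n) ha ltac:(lra) hL); exists X, (- c), (- s).
        split; [lra|]; split; [right; split; lra|]; split; [fold r; lra|].
        intros x y; rewrite HD; lra.
  - right; split.
    + apply Rnot_le_lt; intros N; specialize (S0 ltac:(lra)).
      assert (0 < c) by (apply Rdiv_lt_0_compat; assumption); lra.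
    + apply (refracted_rays_frame h w hw L a (- n) ha ltac:(lra) hL); exists X, (- c), (- s).
      split; [lra|]; split; [left; lra|]; split; [fold r; lra|].
      intros x y; rewrite HD; lra.
Qed.

(** * The adapted frame and the conclusion *)

Lemma adapted_frame (L : point -> Prop) (A B : point) :
  is_line L -> ~ L A -> is_reflection L A B ->
  exists h w a, dot w w = 1 /\ 0 < a /\ A = frame h w 0 a /\ B = frame h w 0 (- a) /\
    forall x y, L (frame h w x y) <-> y = 0.
Proof.
  intros [P [v [v0 HL]]] HA [H [LH [HO ->]]].
  set (a := norm (minus A H)).
  assert (a0 : 0 < a).
  { apply norm_gt_0; intros Z; apply HA.
    replace A with H; [exact LH|].
    destruct A, H; pt_simpl; injection Z; intros; f_equal; lra. }
  assert (a2 : dot (minus A H) (minus A H) = a * a).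
  { unfold a; destruct A as [a1 a2'], H as [h1 h2]; pt_simpl.
    rewrite norm_point, sqrt_sqrt by (apply Rplus_le_le_0_compat; apply pow2_ge_0); ring. }
  set (w := (fst (minus A H) / a, snd (minus A H) / a) : point).
  assert (hw : dot w w = 1).
  { transitivity (dot (minus A H) (minus A H) / (a * a));
      [unfold dot, w; simpl; field; lra | rewrite a2; field; lra]. }
  assert (EA : A = frame H w 0 a).
  { unfold w; destruct A as [a1 a2'], H as [h1 h2]; clearbody a; pt_simpl; f_equal; field; lra. }
  exists H, w, a; split; [exact hw|]; split; [exact a0|]; split; [exact EA|]; split.
  { rewrite EA; destruct H, w; pt_simpl; f_equal; ring. }
  assert (AH : minus A H = frame zero w 0 a).
  { rewrite EA; destruct H, w; pt_simpl; f_equal; ring. }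
  assert (H0 : H = frame H w 0 0) by (destruct H, w; pt_simpl; f_equal; ring).
  intros x y; split.
  - intros Lxy; apply HO in Lxy; rewrite AH in Lxy.
    rewrite H0 in Lxy at 2; rewrite dot_minus_frame in Lxy by exact hw; nra.
  - intros ->; apply HL in LH; destruct LH as [t Ht].
    assert (Ev : v = frame zero w (abscissa zero w v) (ordinate zero w v))
      by apply (frame_coordinates zero w v hw).
    set (p := abscissa zero w v) in Ev; set (q := ordinate zero w v) in Ev.
    assert (q0 : q = 0).
    (* This point of [L] is [H + v], since [H = P + t v]; the perpendicularity at [H] then shows
       that [v] has no component along [w]. *)
    { assert (M : L (plus P (scal (t + 1) v))) by (apply HL; exists (t + 1); reflexivity).
      apply HO in M; rewrite AH in M.
      replace (plus P (scal (t + 1) v)) with (frame H w p q) in M.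
      - rewrite H0 in M at 2; rewrite dot_minus_frame in M by exact hw; nra.
      - rewrite Ht, Ev; destruct P, w; pt_simpl; f_equal; ring. }
    assert (p0 : p <> 0).
    { intros Z; apply v0; rewrite Ev, Z, q0; destruct w; pt_simpl; f_equal; ring. }
    apply HL; exists (t + x / p).
    rewrite Ht, Ev, q0; destruct P, w; clearbody p; pt_simpl; f_equal; field; exact p0.
Qed.

Theorem theorem3p1
    (L : point -> Prop) (A B : point) (n : R)
    (hL : is_line L) (hA : ~ L A) (hB : is_reflection L A B) (hn : n <> 0) :
  (Rabs n < 1 ->
     forall D : point -> Prop,
       (refracted_rays A L n D \/ refracted_rays A L (- n) D) <->
       normals (fun M : point =>
         norm (minus A M) + norm (minus B M) = norm (minus A B) / Rabs n) D)
  /\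
  (Rabs n > 1 ->
     forall D : point -> Prop,
       refracted_rays A L n D <->
       normals (fun M : point =>
         norm (minus A M) - norm (minus B M) = norm (minus A B) / (- n)) D).
Proof.
  destruct (adapted_frame L A B hL hA hB) as [h [w [a [hw [ha [-> [-> HL]]]]]]].
  assert (NA : forall x y, norm (minus (frame h w 0 a) (frame h w x y)) =
    sqrt (x ^ 2 + (a - y) ^ 2)).
  { intros x y; rewrite norm_minus_frame by exact hw; f_equal; ring. }
  assert (NB : forall x y, norm (minus (frame h w 0 (- a)) (frame h w x y)) =
    sqrt (x ^ 2 + (a + y) ^ 2)).
  { intros x y; rewrite norm_minus_frame by exact hw; f_equal; ring. }
  assert (NAB : norm (minus (frame h w 0 a) (frame h w 0 (- a))) = 2 * a).
  { rewrite NA; apply sqrt_lem_1; nra. }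
  assert (np := Rabs_pos n); assert (n2 := pow2_abs n).
  split; intros Hn D; (set (C := fun M : point => _)).
  - assert (h1 : 0 < 1 - n ^ 2) by nra.
    (* The branch clause is vacuous for [0 < 1 - n ^ 2]; it is kept so that both conics share one
       form. *)
    assert (HC : forall x y, C (frame h w x y) <->
      x ^ 2 + (1 - n ^ 2) * y ^ 2 = a ^ 2 * (1 - n ^ 2) / n ^ 2 /\ (1 - n ^ 2 < 0 -> 0 < n * y)).
    { intros x y; unfold C; rewrite NA, NB, NAB, ellipse_equation by assumption.
      split; [intros E; split; [exact E | lra] | intros [E _]; exact E]. }
    split.
    + intros [H | H]; [apply (refracted_ray_is_normal h w hw L C D a n n) in H
                      |apply (refracted_ray_is_normal h w hw L C D a n (- n)) in H];
        assumption || lra.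
    + intros H; apply (normal_is_refracted_ray h w hw L C D a n) in H;
        [destruct H as [H | [_ H]]; auto | assumption | assumption | lra | assumption | assumption].
  - assert (h1 : 1 - n ^ 2 < 0) by nra.
    assert (HC : forall x y, C (frame h w x y) <->
      x ^ 2 + (1 - n ^ 2) * y ^ 2 = a ^ 2 * (1 - n ^ 2) / n ^ 2 /\ (1 - n ^ 2 < 0 -> 0 < n * y)).
    { intros x y; unfold C; rewrite NA, NB, NAB, hyperbola_equation by assumption.
      split; intros [E F]; (split; [exact E | auto]). }
    split.
    + intros H; apply (refracted_ray_is_normal h w hw L C D a n n) in H; assumption || lra.
    + intros H; apply (normal_is_refracted_ray h w hw L C D a n) in H;
        [destruct H as [H | [F _]]; [exact H | lra]
        | assumption | assumption | lra | assumption | assumption].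
Qed.
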